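(* Let $d\geq 5$ be an integer. The largest volume of an isospectral and non-isometric pair of spherical orbifolds of dimension $d$ is at least $\frac18\mathrm{vol}(S^d)$; that is, there exist two $d$-dimensional spherical orbifolds that are isospectral, non-isometric, and of volume at least $\frac18 \mathrm{vol}(S^d)$.
   Context: $S^d$ is the unit sphere in $\mathbb{R}^{d+1}$ with its Riemannian metric of constant sectional curvature one. A $d$-dimensional spherical orbifold is a quotient $S^d/\Gamma$ with $\Gamma$ a finite subgroup of $\mathrm{O}(d+1)$ (not necessarily acting freely); its volume is $\mathrm{vol}(S^d)/|\Gamma|$. Two spherical orbifolds $S^d/\Gamma_1$, $S^d/\Gamma_2$ are isometric if and only if $\Gamma_1,\Gamma_2$ are conjugate in $\mathrm{O}(d+1)$. The spectrum of $S^d/\Gamma$ is the multiset of eigenvalues, counted with multiplicity, of the Laplace-Beltrami operator of $S^d$ acting on $\Gamma$-invariant functions. Two spherical orbifolds are isospectral if their spectra coincide (isospectral ones necessarily have equal volume). *)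

(* Defs.v *)
From HB Require Import structures.
From mathcomp Require Import all_boot all_order all_algebra.
From mathcomp Require Import finmap.
From mathcomp Require Import all_classical all_reals all_analysis.

Set Implicit Arguments.
Unset Strict Implicit.
Unset Printing Implicit Defensive.

Import Order.TTheory GRing.Theory Num.Theory.
Import numFieldNormedType.Exports.

Local Open Scope classical_set_scope.
Local Open Scope ring_scope.

Section SmoothFunctions.
Context {R : realType} {n : nat}.
Implicit Types (U : set 'cV[R]_n) (h : 'cV[R]_n -> R).

Definition partial (i : 'I_n) h : 'cV[R]_n -> R :=
  fun u => 'D_(delta_mx i 0) h u.

(* Functions are total; only their germs at points of the open set [U] matter. *)
Fixpoint Ck_on (k : nat) U h : Prop :=
  (forall u, U u -> {for u, continuous h}) /\
  match k with
  | 0 => True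
  | k'.+1 => forall i : 'I_n,
      (forall u, U u -> derivable h u (delta_mx i 0)) /\
      Ck_on k' U (partial i h)
  end.

Definition smooth_on U h : Prop := forall k : nat, Ck_on k U h.

End SmoothFunctions.

Section LaplaceBeltrami.
Context {R : realType} {d : nat}.

Definition dot {n : nat} (x y : 'cV[R]_n) : R := \sum_i x i 0 * y i 0.

Definition sphere : set 'cV[R]_d.+1 := [set x | dot x x = 1].

Definition tangent (phi : 'cV[R]_d -> 'cV[R]_d.+1) (i : 'I_d) (u : 'cV[R]_d) :
    'cV[R]_d.+1 :=
  \col_k partial i (fun v => phi v k 0) u.

(* First fundamental form of [phi], i.e. the pullback of the round metric. *)
Definition metric (phi : 'cV[R]_d -> 'cV[R]_d.+1) (u : 'cV[R]_d) : 'M[R]_d :=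
  \matrix_(i, j) dot (tangent phi i u) (tangent phi j u).

(* An injective immersion between manifolds of the same dimension [d] is a
   diffeomorphism onto an open subset of the sphere, so these are exactly the
   inverses of the smooth charts of the sphere.  Invertibility of the Gram
   matrix of the tangent vectors says that [phi] is an immersion. *)
Definition local_parametrization
    (U : set 'cV[R]_d) (phi : 'cV[R]_d -> 'cV[R]_d.+1) : Prop :=
  [/\ open U,
      forall u, U u -> sphere (phi u),
      {in U &, injective phi},
      forall k, smooth_on U (fun u => phi u k 0)
    & forall u, U u -> metric phi u \in unitmx].

(* - (det g)^(-1/2) \sum_(i, j) d_i ((det g)^(1/2) g^(ij) d_j h); the sign is
   chosen so that the spectrum is nonnegative. *)
Definition laplace_beltrami (g : 'cV[R]_d -> 'M[R]_d) (h : 'cV[R]_d -> R)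
    (u : 'cV[R]_d) : R :=
  - (Num.sqrt (\det (g u)))^-1 *
    \sum_i partial i (fun v => Num.sqrt (\det (g v)) *
                        \sum_j invmx (g v) i j * partial j h v) u.

(* A function on the sphere is represented by a function on the ambient space,
   of which only the restriction to the sphere is ever considered. *)
Definition laplace_eigenfunction (lambda : R) (f : 'cV[R]_d.+1 -> R) : Prop :=
  forall U phi, local_parametrization U phi ->
    smooth_on U (f \o phi) /\
    forall u, U u ->
      laplace_beltrami (metric phi) (f \o phi) u = lambda * f (phi u).

Definition free_on_sphere (m : nat) (f : 'I_m -> 'cV[R]_d.+1 -> R) : Prop :=
  forall c : 'I_m -> R,
    (forall x, sphere x -> \sum_i c i * f i x = 0) -> forall i, c i = 0.

(* Distance on the unit sphere induced by its Riemannian metric. *)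
Definition sphere_dist (x y : 'cV[R]_d.+1) : R := acos (dot x y).

End LaplaceBeltrami.

(* The [d]-dimensional volume of the unit sphere of R^(d+1), computed in
   geodesic polar coordinates around a pole, in which the metric of S^(d+1) is
   dt^2 + sin(t)^2 g_(S^d); S^0 consists of two points. *)
Fixpoint sphere_vol (R : realType) (d : nat) : R :=
  match d with
  | 0 => 2
  | d'.+1 => sphere_vol R d' *
      (\int[@lebesgue_measure R]_(t in `[0, pi]) (sin t ^+ d'))%R
  end.

(* The spherical orbifold S^d/Gamma is represented by Gamma. *)
Record spherical_orbifold (R : realType) (d : nat) := SphericalOrbifold {
  orbifold_group : {fset 'M[R]_d.+1};
  orbifold_group_orthogonal :
    forall A, A \in orbifold_group -> A^T *m A = 1%:M;
  orbifold_group1 : 1%:M \in orbifold_group;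
  orbifold_groupM : forall A B, A \in orbifold_group ->
    B \in orbifold_group -> A *m B \in orbifold_group;
  orbifold_groupV : forall A, A \in orbifold_group ->
    invmx A \in orbifold_group
}.

Section SphericalOrbifolds.
Context {R : realType} {d : nat}.
Implicit Types X Y : spherical_orbifold R d.

Definition orbifold_vol X : R := sphere_vol R d / #|` orbifold_group X|%:R.

Definition invariant X (f : 'cV[R]_d.+1 -> R) : Prop :=
  forall A x, A \in orbifold_group X -> sphere x -> f (A *m x) = f x.

(* The spectrum, as a multiset, is its multiplicity function: [spectrum X
   lambda] is the dimension of the space of invariant eigenfunctions for
   [lambda], which is 0 when [lambda] is not an eigenvalue. *)
Definition spectrum X (lambda : R) : \bar R :=
  ereal_sup [set (m%:R)%:E | m in [set m : nat |
    exists f : 'I_m -> 'cV[R]_d.+1 -> R,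
      free_on_sphere f /\
      forall i, laplace_eigenfunction lambda (f i) /\ invariant X (f i)]].

Definition isospectral X Y : Prop := spectrum X =1 spectrum Y.

Definition orbit X (x : 'cV[R]_d.+1) : set 'cV[R]_d.+1 :=
  [set A *m x | A in [set A | A \in orbifold_group X]].

Definition orbifold_points X : set (set 'cV[R]_d.+1) :=
  [set orbit X x | x in sphere].

Definition orbit_dist (p q : set 'cV[R]_d.+1) : R :=
  inf [set r | exists x y, [/\ p x, q y & r = sphere_dist x y]].

(* The Riemannian orbifold structure of a quotient of the sphere is determined
   by its distance function, so isometries of orbifolds are the bijections that
   preserve the quotient distance. *)
Definition isometric X Y : Prop :=
  exists F : set 'cV[R]_d.+1 -> set 'cV[R]_d.+1,
    set_bij (orbifold_points X) (orbifold_points Y) F /\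
    forall p q, orbifold_points X p -> orbifold_points X q ->
      orbit_dist (F p) (F q) = orbit_dist p q.

End SphericalOrbifolds.

(* Main.v *)
Require Import Defs.
From mathcomp Require Import all_boot all_order all_algebra.
From mathcomp Require Import fingroup perm.
From mathcomp Require Import finmap.
From mathcomp Require Import all_classical all_reals all_analysis.
From mathcomp Require Import lra ring.

(** Both orbifolds are quotients by groups of eight diagonal matrices with
    entries +1 and -1, that is by binary linear codes of dimension 3 living on
    the first six coordinates: a codeword prescribes the coordinates whose sign
    changes.  The matching code is generated by the pairs {0,5}, {1,3}, {2,4};
    the triangle code by the pairs {0,1}, {1,2} and by all six coordinates.
    They have the same weight enumerator 1 + 3y^2 + 3y^4 + y^6 without being
    equivalent.

    Isospectrality.  Any function f is the sum of its parity components, one for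
    each set K of coordinates, where the component of K is odd in the
    coordinates of K and even in the others.  The invariant functions of a sign
    group are those whose components sit on the dual code.  A permutation of the
    coordinates moving K to K' carries the functions of parity K to those of
    parity K', and commutes with the Laplacian because it is an isometry.  Thus
    a weight-preserving bijection between the dual codes ([swap_signs]) gives,
    component by component, a linear injection from the invariant eigenfunctions
    of one quotient to those of the other ([spectrum_transplant]).  What this
    needs from analysis is that eigenfunctions are stable under linear
    combinations ([laplace_eigenfunction_lincomb]) and under orthogonal
    substitutions ([laplace_eigenfunction_mulmx]).

    Non-isometry.  A point of the quotient has an antipode, i.e. a point at
    distance pi, only if its first six coordinates vanish; so the points at
    distance pi/2 from all those having an antipode form the quotient of the
    sphere of the first six coordinates.  There, distance pi/2 between the
    orbits of x and y means that x and y have orthogonal projections on every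
    isotypic component of the sign group.  For the triangle code the line of
    coordinate 0 is an isotypic component, so its orbit p satisfies: if q is not
    at distance pi/2 from p while r is at distance pi/2 from q, then r is at
    distance pi/2 from p.  For the matching code all the components of the
    first six coordinates are planes, and no point has this property, as one
    sees by rotating in the plane ([no_join_vertex_matching]). *)

Set Implicit Arguments.
Unset Strict Implicit.
Unset Printing Implicit Defensive.

Import Order.TTheory GRing.Theory Num.Theory.
Import numFieldNormedType.Exports.

Local Open Scope classical_set_scope.
Local Open Scope ring_scope.

(** * Directional derivatives and smooth functions *)

Section DirectionalDerivatives.
Context {R : realType} {V : normedModType R}.
Implicit Types (f g : V -> R) (x v : V).

Lemma derivable_lin a f g x v : derivable f x v -> derivable g x v ->
  derivable (fun y => a * f y + g y) x v.
Proof.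
move=> df dg; have daf := derivableM (derivable_cst a x v) df.
exact: derivableD daf dg.
Qed.

Lemma derive_lin a f g x v : derivable f x v -> derivable g x v ->
  'D_v (fun y => a * f y + g y) x = a * 'D_v f x + 'D_v g x.
Proof.
move=> df dg; have daf := derivableM (derivable_cst a x v) df.
have -> : a * 'D_v f x = 'D_v (a \*o f) x by rewrite deriveMl.
exact: deriveD daf dg.
Qed.

Lemma derivable_sumf (I : Type) (r : seq I) (F : I -> V -> R) x v :
  (forall i, derivable (F i) x v) ->
  derivable (fun y => \sum_(i <- r) F i y) x v.
Proof.
move=> dF; elim: r => [|i r IH].
  by under eq_fun do rewrite big_nil; exact: derivable_cst.
rewrite (_ : (fun y => _) = F i + (fun y => \sum_(j <- r) F j y)).
  exact: derivableD (dF i) IH.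
by apply: funext => y; rewrite big_cons.
Qed.

Lemma derive_lincomb (I : Type) (r : seq I) (a : I -> R) (F : I -> V -> R) x v :
  (forall i, derivable (F i) x v) ->
  'D_v (fun y => \sum_(i <- r) a i * F i y) x =
  \sum_(i <- r) a i * 'D_v (F i) x.
Proof.
move=> dF; elim: r => [|i r IH].
  rewrite big_nil (_ : (fun y => _) = cst 0) ?derive_cst//.
  by apply: funext => y; rewrite big_nil.
rewrite big_cons -IH -derive_lin//.
  by congr ('D_v _ x); apply: funext => y; rewrite big_cons.
apply: derivable_sumf => j.
exact: (derivableM (derivable_cst (a j) x v) (dF j)).
Qed.

Lemma derivable_prodf (I : Type) (r : seq I) (F : I -> V -> R) x v :
  (forall i, derivable (F i) x v) ->
  derivable (fun y => \prod_(i <- r) F i y) x v.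
Proof.
move=> dF; elim: r => [|i r IH].
  by under eq_fun do rewrite big_nil; exact: derivable_cst.
rewrite (_ : (fun y => _) = F i * (fun y => \prod_(j <- r) F j y)).
  exact: derivableM (dF i) IH.
by apply: funext => y; rewrite big_cons.
Qed.

Lemma derivable_det n (M : V -> 'M[R]_n) x v :
  (forall i j, derivable (fun y => M y i j) x v) ->
  derivable (fun y => \det (M y)) x v.
Proof.
move=> dM; apply: derivable_sumf => s.
by apply: (derivableM (derivable_cst _ _ _)); apply: derivable_prodf.
Qed.

(** Where f is negative, the total square root of f is locally zero; thus only
    the zeros of f are singular. *)
Lemma derivable_sqrt f x v : f x != 0 -> derivable f x v ->
  derivable (fun y => Num.sqrt (f y)) x v.
Proof.
move=> f0 df; apply/derivable1P.
have /derivable1_diffP dfl := (derivable1P _ _ _).1 df.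
have f0E : f (0 *: v + x) = f x by rewrite scale0r add0r.
move: f0; rewrite neq_lt => /orP[fx0|fx0].
  apply: (@near_eq_derivable _ _ _ (cst 0)); last exact: derivable_cst.
  have fc := differentiable_continuous dfl.
  have : \forall h \near (0 : R), f (h *: v + x) < 0.
    by apply: (cvgr_lt (f (0 *: v + x)) fc); rewrite f0E.
  by apply: filterS => h /ltW fh; rewrite ler0_sqrtr.
apply/derivable1_diffP.
apply: (@differentiable_comp _ _ _ _ _ (@Num.sqrt R)) => //.
apply/derivable1_diffP.
have fp : 0 < f (0 *: v + x) by rewrite f0E.
by case: (is_derive1_sqrt fp).
Qed.

End DirectionalDerivatives.

Section SmoothLinear.
Context {R : realType} {n : nat}.
Implicit Types (U : set 'cV[R]_n) (h : 'cV[R]_n -> R).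

Lemma open_near_eq U h h' u : open U -> (forall v, U v -> h v = h' v) ->
  U u -> \forall v \near u, h v = h' v.
Proof.
by move=> oU hh Uu; have := open_nbhs_nbhs (conj oU Uu); apply: filterS.
Qed.

(** Differentiation is local; this is what allows computing partial derivatives
    by formulas which hold on the open set U only. *)
Lemma eq_Ck_on k U h h' : open U -> (forall u, U u -> h u = h' u) ->
  Ck_on k U h -> Ck_on k U h'.
Proof.
move=> oU.
have eq_cont (f g : 'cV[R]_n -> R) u : (forall v, U v -> f v = g v) -> U u ->
    {for u, continuous f} -> {for u, continuous g}.
  move=> fg Uu fc; have near_fg := open_near_eq oU fg Uu.
  have : g @ u --> f u by exact: cvg_trans (near_eq_cvg near_fg) fc.
  by rewrite (fg u Uu).
elim: k h h' => [|k IH] h h' hh' [hc hd]; split.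
- by move=> u Uu; apply: eq_cont (hc u Uu) => //.
- by [].
- by move=> u Uu; apply: eq_cont (hc u Uu) => //.
- move=> i; have [dh Ch] := hd i; split.
    move=> u Uu; apply: near_eq_derivable (dh u Uu).
    exact: open_near_eq hh' Uu.
  apply: IH Ch => u Uu; apply: near_eq_derive.
  exact: open_near_eq hh' Uu.
Qed.

Lemma Ck_on_lin k U a h h' : open U -> Ck_on k U h -> Ck_on k U h' ->
  Ck_on k U (fun u => a * h u + h' u).
Proof.
move=> oU; have cont_lin (f g : 'cV[R]_n -> R) u : {for u, continuous f} ->
    {for u, continuous g} -> {for u, continuous (fun v => a * f v + g v)}.
  by move=> fc gc; exact: cvgD (cvgM (cvg_cst a) fc) gc.
elim: k h h' => [|k IH] h h' [hc hd] [hc' hd']; split => //.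
- by move=> u Uu; apply: cont_lin; [exact: hc|exact: hc'].
- by move=> u Uu; apply: cont_lin; [exact: hc|exact: hc'].
- move=> i; have [dh Ch] := hd i; have [dh' Ch'] := hd' i; split.
    by move=> u Uu; apply: derivable_lin; [exact: dh|exact: dh'].
  apply: eq_Ck_on (IH _ _ Ch Ch') => // u Uu.
  by rewrite /partial derive_lin//; [exact: dh|exact: dh'].
Qed.

Lemma smooth_on_lin U a h h' : open U -> smooth_on U h -> smooth_on U h' ->
  smooth_on U (fun u => a * h u + h' u).
Proof. by move=> oU Sh Sh' k; apply: Ck_on_lin. Qed.

Lemma smooth_on0 U : open U -> smooth_on U (fun=> 0).
Proof.
move=> oU; elim=> [|k IH]; split => //;
  try by move=> u _; exact: cst_continuous.
move=> i; split=> [u _|]; first exact: derivable_cst.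
by apply: eq_Ck_on IH => // u _; rewrite /partial derive_cst.
Qed.

Lemma smooth_on_lincomb U (I : Type) (r : seq I) (a : I -> R)
    (F : I -> 'cV[R]_n -> R) : open U -> (forall i, smooth_on U (F i)) ->
  smooth_on U (fun u => \sum_(i <- r) a i * F i u).
Proof.
move=> oU SF; elim: r => [|i r IH].
  by under eq_fun do rewrite big_nil; exact: smooth_on0.
by under eq_fun do rewrite big_cons; exact: smooth_on_lin.
Qed.

Lemma smooth_on_derivable U h i u : smooth_on U h -> U u ->
  derivable h u (delta_mx i 0).
Proof. by move=> Sh Uu; case: (Sh 1%N) => _ /(_ i) [/(_ u Uu)]. Qed.

Lemma partial_lincomb U (I : Type) (r : seq I) (a : I -> R)
    (F : I -> 'cV[R]_n -> R) i u : U u -> (forall i, smooth_on U (F i)) ->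
  partial i (fun v => \sum_(j <- r) a j * F j v) u =
  \sum_(j <- r) a j * partial i (F j) u.
Proof.
by move=> Uu SF; apply: derive_lincomb => j; apply: smooth_on_derivable Uu.
Qed.

Lemma smooth_on_derivable_partial U h i j u : smooth_on U h -> U u ->
  derivable (partial j h) u (delta_mx i 0).
Proof.
move=> Sh Uu; case: (Sh 2%N) => _ /(_ j) [_ [_ /(_ i) [/(_ u Uu)]]] //.
Qed.

End SmoothLinear.

(** * The Laplace-Beltrami operator: linearity and orthogonal invariance *)

Section LaplaceBeltramiTheory.
Context {R : realType} {d : nat}.
Implicit Types (U : set 'cV[R]_d) (phi : 'cV[R]_d -> 'cV[R]_d.+1).
Implicit Types (g : 'cV[R]_d -> 'M[R]_d) (h : 'cV[R]_d -> R).
Implicit Types (f : 'cV[R]_d.+1 -> R) (A : 'M[R]_d.+1).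

(** The vector field sqrt(det g) grad h, of which the Laplace-Beltrami operator
    takes the divergence. *)
Let flux g i h v : R :=
  Num.sqrt (\det (g v)) * \sum_j invmx (g v) i j * partial j h v.

Lemma derivable_metric U phi u i j l : local_parametrization U phi -> U u ->
  derivable (fun v => metric phi v i j) u (delta_mx l 0).
Proof.
move=> [oU _ _ Sphi _] Uu.
have -> : (fun v => metric phi v i j) = fun v =>
    \sum_k partial i (fun w => phi w k 0) v * partial j (fun w => phi w k 0) v.
  by apply: funext => v; rewrite mxE; apply: eq_bigr => k _;
    rewrite mxE [X in _ * X]mxE.
apply: derivable_sumf => k.
have dp m : derivable (partial m (fun w => phi w k 0)) u (delta_mx l 0).
  exact: smooth_on_derivable_partial (Sphi k) Uu.
exact: derivableM (dp i) (dp j).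
Qed.

(** By Cramer, the entries of the inverse metric are quotients of polynomials in
    the entries of the metric, with denominator the nonzero Gram determinant;
    hence the flux of a smooth function is differentiable. *)
Lemma derivable_flux U phi h u i : local_parametrization U phi -> U u ->
  smooth_on U h -> derivable (flux (metric phi) i h) u (delta_mx i 0).
Proof.
move=> Lphi Uu Sh; have [oU _ _ _ uphi] := Lphi.
have dm k l : derivable (fun v => metric phi v k l) u (delta_mx i 0).
  exact: derivable_metric Lphi Uu.
have det_neq0 v : U v -> \det (metric phi v) != 0.
  by move=> /uphi; rewrite unitmxE unitfE.
have ddet := derivable_det dm; set detg := (fun v => _) in ddet.
have dinv j : derivable (fun v => invmx (metric phi v) i j) u (delta_mx i 0).
  apply: (@near_eq_derivable _ _ _ (fun v => (\det (metric phi v))^-1 *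
      ((-1) ^+ (j + i) * \det (row' j (col' i (metric phi v)))))).
    apply: open_near_eq oU _ Uu => v Uv.
    by rewrite /invmx uphi// !mxE.
  have dminor : derivable (fun v => \det (row' j (col' i (metric phi v)))) u
      (delta_mx i 0).
    apply: derivable_det => k l.
    apply: near_eq_derivable (dm (lift j k) (lift i l)).
    by apply: open_near_eq oU _ Uu => v _; rewrite [RHS]mxE [RHS]mxE.
  have dV := derivableV (f := detg) (det_neq0 u Uu) ddet.
  have dcof := derivableM (derivable_cst ((-1) ^+ (j + i) : R) _ _) dminor.
  exact: derivableM dV dcof.
have dS : derivable (fun v => \sum_j invmx (metric phi v) i j * partial j h v) u
    (delta_mx i 0).
  apply: derivable_sumf => j.
  exact: derivableM (dinv j) (smooth_on_derivable_partial Sh Uu).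
exact: derivableM (derivable_sqrt (f := detg) (det_neq0 u Uu) ddet) dS.
Qed.

Lemma laplace_beltrami_lincomb U phi (I : Type) (r : seq I) (a : I -> R)
    (F : I -> 'cV[R]_d -> R) u :
  local_parametrization U phi -> U u -> (forall i, smooth_on U (F i)) ->
  laplace_beltrami (metric phi) (fun v => \sum_(i <- r) a i * F i v) u =
  \sum_(i <- r) a i * laplace_beltrami (metric phi) (F i) u.
Proof.
move=> Lphi Uu SF; have [oU _ _ _ _] := Lphi.
have dflux (i : 'I_d) :
    partial i (flux (metric phi) i (fun v => \sum_(k <- r) a k * F k v)) u =
    \sum_(k <- r) a k * partial i (flux (metric phi) i (F k)) u.
  rewrite /partial -derive_lincomb; last first.
    by move=> k; apply: derivable_flux Lphi Uu (SF k).
  apply: near_eq_derive; apply: open_near_eq oU _ Uu => v Uv.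
  rewrite /flux (eq_bigr (fun j : 'I_d => \sum_(k <- r)
      a k * (invmx (metric phi v) i j * partial j (F k) v))); last first.
    move=> j _; rewrite (partial_lincomb _ _ _ Uv SF) mulr_sumr.
    by apply: eq_bigr => k _; rewrite mulrCA.
  rewrite exchange_big mulr_sumr; apply: eq_bigr => k _.
  by rewrite -mulr_sumr mulrCA.
rewrite /laplace_beltrami; transitivity (- (Num.sqrt (\det (metric phi u)))^-1 *
    \sum_i \sum_(k <- r) a k * partial i (flux (metric phi) i (F k)) u).
  by congr (_ * _); apply: eq_bigr => i _; exact: dflux.
rewrite exchange_big mulr_sumr; apply: eq_bigr => k _.
by rewrite -mulr_sumr mulrCA.
Qed.

Lemma eq_laplace_beltrami U g g' h u : open U -> U u ->
  (forall v, U v -> g v = g' v) ->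
  laplace_beltrami g h u = laplace_beltrami g' h u.
Proof.
move=> oU Uu gg; rewrite /laplace_beltrami gg//; congr (_ * _).
apply: eq_bigr => i _; apply: near_eq_derive.
by apply: open_near_eq oU _ Uu => v Uv; rewrite gg.
Qed.

Lemma dot_mulmx n (A : 'M[R]_n) (x y : 'cV[R]_n) : A^T *m A = 1%:M ->
  dot (A *m x) (A *m y) = dot x y.
Proof.
have dotE (z w : 'cV[R]_n) : dot z w = (z^T *m w) 0 0.
  by rewrite mxE; apply: eq_bigr => i _; rewrite mxE.
by move=> AA; rewrite !dotE trmx_mul -mulmxA [A^T *m _]mulmxA AA mul1mx.
Qed.

Lemma tangent_mulmx U phi A i u : local_parametrization U phi -> U u ->
  tangent (fun v => A *m phi v) i u = A *m tangent phi i u.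
Proof.
move=> [oU _ _ Sphi _] Uu; apply/colP => k; rewrite !mxE.
have -> : (fun v => (A *m phi v) k 0) =
    fun v => \sum_l A k l * (fun w => phi w l 0) v.
  by apply: funext => v; rewrite mxE.
by rewrite (partial_lincomb _ _ _ Uu Sphi); apply: eq_bigr => l _; rewrite mxE.
Qed.

(** A constant orthogonal matrix commutes with partial derivatives and preserves
    dot products, hence the first fundamental form. *)
Lemma metric_mulmx U phi A u : A^T *m A = 1%:M ->
  local_parametrization U phi -> U u ->
  metric (fun v => A *m phi v) u = metric phi u.
Proof.
move=> AA Lphi Uu; apply/matrixP => i j; rewrite !mxE.
by rewrite !(tangent_mulmx _ _ Lphi Uu) dot_mulmx.
Qed.

Lemma local_parametrization_mulmx U phi A : A^T *m A = 1%:M ->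
  local_parametrization U phi ->
  local_parametrization U (fun v => A *m phi v).
Proof.
move=> AA Lphi; have [oU sphi iphi Sphi uphi] := Lphi; split => //.
- by move=> u Uu; rewrite /sphere /= dot_mulmx//; exact: sphi.
- move=> u v Uu Uv /(congr1 (mulmx A^T)).
  by rewrite !mulmxA AA !mul1mx; apply: iphi.
- move=> k; under eq_fun do rewrite mxE.
  by apply: smooth_on_lincomb oU _ => l; exact: Sphi.
- by move=> u Uu; rewrite (metric_mulmx AA Lphi Uu); exact: uphi.
Qed.

(** Substituting A x in f amounts to reading f in the parametrization A phi,
    which induces the same metric as phi. *)
Lemma laplace_eigenfunction_mulmx lambda f A : A^T *m A = 1%:M ->
  laplace_eigenfunction lambda f ->
  laplace_eigenfunction lambda (fun x => f (A *m x)).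
Proof.
move=> AA Ef U phi Lphi; have [oU _ _ _ _] := Lphi.
have [Sf Df] := Ef U _ (local_parametrization_mulmx AA Lphi).
split; first exact: Sf.
move=> u Uu; apply: etrans (Df u Uu).
apply: (eq_laplace_beltrami _ oU Uu) => v Uv; apply: esym.
exact: metric_mulmx AA Lphi Uv.
Qed.

Lemma laplace_eigenfunction_lincomb lambda (I : Type) (r : seq I) (a : I -> R)
    (F : I -> 'cV[R]_d.+1 -> R) :
  (forall i, laplace_eigenfunction lambda (F i)) ->
  laplace_eigenfunction lambda (fun x => \sum_(i <- r) a i * F i x).
Proof.
move=> EF U phi Lphi; have [oU _ _ _ _] := Lphi.
have SF i : smooth_on U (F i \o phi) by case: (EF i U phi Lphi).
split=> [|u Uu]; first exact: (smooth_on_lincomb r a oU SF).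
rewrite [LHS](laplace_beltrami_lincomb r a Lphi Uu SF) mulr_sumr.
by apply: eq_bigr => i _; rewrite (EF i U phi Lphi).2// mulrCA.
Qed.

End LaplaceBeltramiTheory.

(** * Parity components of a function *)

Section ParityComponents.
Context {R : realType} {d : nat}.
Local Notation n := d.+1.
Local Notation signs := {ffun 'I_n -> bool}.
Implicit Types (S T K : signs) (f : 'cV[R]_n -> R) (x : 'cV[R]_n).

(** The pairing of binary words with respect to which dual codes are taken. *)
Definition parity S K : bool := \big[addb/false]_i (S i && K i).

Definition add_signs S T : signs := [ffun i => S i (+) T i].

Definition no_sign : signs := [ffun=> false].

Definition flip S : 'M[R]_n := diag_mx (\row_i (-1) ^+ S i).

Lemma add_signsC S T : add_signs S T = add_signs T S.
Proof. by apply/ffunP => i; rewrite !ffunE addbC. Qed.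

Lemma add_signsK T : involutive (add_signs T).
Proof. by move=> S; apply/ffunP => i; rewrite !ffunE addKb. Qed.

Lemma add_signs_eq0 S T : (add_signs S T == no_sign) = (S == T).
Proof.
apply/eqP/eqP => [ST|->]; last by apply/ffunP => i; rewrite !ffunE addbb.
rewrite -(add_signsK T S) [add_signs T S]add_signsC ST.
by apply/ffunP => i; rewrite !ffunE addbF.
Qed.

Lemma parityC S K : parity S K = parity K S.
Proof. by apply: eq_bigr => i _; rewrite andbC. Qed.

Lemma parityDl S T K : parity (add_signs S T) K = parity S K (+) parity T K.
Proof.
by rewrite /parity -big_split; apply: eq_bigr => i _; rewrite ffunE andb_addl.
Qed.

Lemma parity_comp S K (s : 'S_n) :
  parity [ffun i => S (s i)] [ffun i => K (s i)] = parity S K.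
Proof.
rewrite {2}/parity (reindex_inj (@perm_inj _ s)).
by apply: eq_bigr => i _; rewrite !ffunE.
Qed.

Lemma flipE S x i : (flip S *m x) i 0 = (-1) ^+ S i * x i 0.
Proof. by rewrite mul_diag_mx !mxE. Qed.

Lemma flipD S T x : flip S *m (flip T *m x) = flip (add_signs S T) *m x.
Proof. by apply/colP => i; rewrite !flipE mulrA -signr_addb ffunE. Qed.

Lemma flip0 x : flip no_sign *m x = x.
Proof. by apply/colP => i; rewrite flipE ffunE mul1r. Qed.

Lemma flip_orthogonal S : (flip S)^T *m flip S = 1%:M.
Proof.
rewrite tr_diag_mx mulmx_diag -diag_const_mx; congr diag_mx.
by apply/rowP => i; rewrite !mxE -signr_addb addbb.
Qed.

Lemma perm_mx_orthogonal (s : 'S_n) :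
  (perm_mx s)^T *m perm_mx s = 1%:M :> 'M[R]_n.
Proof. by rewrite tr_perm_mx -perm_mxM mulVg perm_mx1. Qed.

Lemma perm_mx_flip (s : 'S_n) S x :
  perm_mx s *m (flip S *m x) = flip [ffun i => S (s i)] *m (perm_mx s *m x).
Proof.
apply/colP => i; rewrite flipE -!row_permE [LHS]mxE flipE ffunE.
by rewrite [X in _ = _ * X]mxE.
Qed.

Lemma sphere_mulmx (A : 'M[R]_n) x : A^T *m A = 1%:M -> sphere x ->
  sphere (A *m x).
Proof. by move=> AA Sx; rewrite /sphere /= dot_mulmx. Qed.

Lemma sphere_flip S x : sphere x -> sphere (flip S *m x).
Proof. exact: sphere_mulmx (flip_orthogonal S). Qed.

(** Orthogonality of the characters of the group of sign vectors: the sum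
    factors over the coordinates, and a factor vanishes as soon as K is nonzero
    at that coordinate. *)
Lemma sum_characters K :
  \sum_S (-1) ^+ parity S K = (K == no_sign)%:R * 2 ^+ n :> R.
Proof.
have -> : \sum_S (-1) ^+ parity S K = \prod_i \sum_b (-1) ^+ (b && K i) :> R.
  rewrite bigA_distr_bigA; apply: eq_bigr => S _.
  apply: (big_morph (fun b : bool => (-1) ^+ b)) => // a b.
  by rewrite signr_addb.
case: eqVneq => [->|K0].
  rewrite mul1r (eq_bigr (fun=> 2)) ?prodr_const ?card_ord// => i _.
  by rewrite big_bool !ffunE.
have [i Ki] : exists i, K i.
  apply/existsP; apply: contra_neqT K0 => /existsPn K0.
  by apply/ffunP => i; rewrite ffunE; apply/negbTE/K0.
by rewrite (bigD1 i)//= big_bool Ki /= addNr !mul0r.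
Qed.

Definition has_parity K f :=
  forall S x, sphere x -> f (flip S *m x) = (-1) ^+ parity S K * f x.

(** The projection on the functions of parity K, as the average of f over all
    sign changes against the character of K. *)
Definition component K f x : R :=
  \sum_S ((-1) ^+ parity S K / 2 ^+ n) * f (flip S *m x).

Let pow2_neq0 : 2 ^+ n != 0 :> R.
Proof. by rewrite expf_neq0// pnatr_eq0. Qed.

(** Fourier inversion on the group of sign vectors. *)
Lemma sum_component f x : \sum_K component K f x = f x.
Proof.
rewrite exchange_big /= (bigD1 no_sign)//= [X in _ + X]big1 => [|S S0].
  rewrite flip0 -mulr_suml -mulr_suml.
  under eq_bigr do rewrite parityC.
  by rewrite sum_characters eqxx mul1r mulfV// mul1r addr0.
rewrite -mulr_suml -mulr_suml; under eq_bigr do rewrite parityC.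
by rewrite sum_characters (negbTE S0) !mul0r.
Qed.

Lemma component_parity K f : has_parity K (component K f).
Proof.
move=> S x _; rewrite /component mulr_sumr.
rewrite (reindex_inj (can_inj (add_signsK S))); apply: eq_bigr => T _.
rewrite flipD [add_signs (add_signs S T) S]add_signsC add_signsK.
by rewrite parityDl signr_addb !mulrA.
Qed.

Lemma component_of_parity K K' f x : has_parity K' f -> sphere x ->
  component K f x = (K == K')%:R * f x.
Proof.
move=> fK' Sx.
transitivity ((\sum_S (-1) ^+ parity S (add_signs K K')) / 2 ^+ n * f x).
  rewrite !mulr_suml; apply: eq_bigr => S _; rewrite fK'// mulrA; congr (_ * _).
  by rewrite mulrAC -signr_addb ![parity S _]parityC parityDl.
by rewrite sum_characters add_signs_eq0 mulfK.
Qed.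

(** Invariance under S makes the component even under S, whereas its parity
    makes it odd. *)
Lemma component_invariant S K f x : sphere x -> parity S K ->
  (forall y, sphere y -> f (flip S *m y) = f y) -> component K f x = 0.
Proof.
move=> Sx SK fS; have /esym := component_parity K f S Sx.
have -> : component K f (flip S *m x) = component K f x.
  apply: eq_bigr => T _.
  by rewrite flipD add_signsC -flipD fS//; exact: sphere_flip.
rewrite SK mulN1r => /eqP; rewrite -subr_eq0 -opprD oppr_eq0 -mulr2n.
by rewrite mulrn_eq0 => /eqP.
Qed.

Lemma component_lincomb (I : Type) (r : seq I) (c : I -> R)
    (F : I -> 'cV[R]_n -> R) K x :
  component K (fun y => \sum_(i <- r) c i * F i y) x =
  \sum_(i <- r) c i * component K (F i) x.
Proof.
rewrite /component; under eq_bigr do rewrite mulr_sumr.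
rewrite exchange_big; apply: eq_bigr => i _; rewrite mulr_sumr.
by apply: eq_bigr => S _; rewrite mulrCA.
Qed.

Lemma laplace_eigenfunction_component lambda K f :
  laplace_eigenfunction lambda f ->
  laplace_eigenfunction lambda (component K f).
Proof.
move=> Ef; apply: laplace_eigenfunction_lincomb => S.
exact: laplace_eigenfunction_mulmx (flip_orthogonal S) Ef.
Qed.

End ParityComponents.

(** * Quotients by sign groups and transplantation of eigenfunctions *)

Lemma sphere_vol_ge0 (R : realType) m : 0 <= sphere_vol R m.
Proof.
elim: m => [|m IH] //=; apply: mulr_ge0 => //.
apply: Rintegral_ge0 => t; rewrite /= in_itv /= => tpi.
by rewrite exprn_ge0// sin_ge0_pi.
Qed.

Section SignOrbifolds.
Context {R : realType} {d : nat} {I : finType}.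
Local Notation n := d.+1.
Local Notation signs := {ffun 'I_n -> bool}.
(* The code is the range of w. *)
Variable w : I -> signs.
Hypothesis w0 : exists i, w i = no_sign.
Hypothesis wD : forall i j, exists k, w k = add_signs (w i) (w j).

Definition sign_group : {fset 'M[R]_n} := [fset flip (w i) | i in predT]%fset.

Lemma sign_groupP A : reflect (exists i, A = flip (w i)) (A \in sign_group).
Proof.
by apply: (iffP (imfsetP _ _ _ _)) => [[i _ ->]|[i ->]]; exists i.
Qed.

Lemma mulmx_flip S T : flip S *m flip T = flip (add_signs S T) :> 'M[R]_n.
Proof.
rewrite mulmx_diag; congr diag_mx.
by apply/rowP => i; rewrite !mxE ffunE signr_addb.
Qed.

Lemma flip_no_sign : flip no_sign = 1%:M :> 'M[R]_n.
Proof.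
rewrite -diag_const_mx; congr diag_mx.
by apply/rowP => i; rewrite !mxE ffunE.
Qed.

Let sign_group_orthogonal A : A \in sign_group -> A^T *m A = 1%:M.
Proof. by move=> /sign_groupP[i ->]; exact: flip_orthogonal. Qed.

Let sign_group1 : 1%:M \in sign_group.
Proof.
have [i wi] := w0; apply/sign_groupP; exists i.
by rewrite wi flip_no_sign.
Qed.

Let sign_groupM A B : A \in sign_group -> B \in sign_group ->
  A *m B \in sign_group.
Proof.
move=> /sign_groupP[i ->] /sign_groupP[j ->]; have [k wk] := wD i j.
by apply/sign_groupP; exists k; rewrite wk mulmx_flip.
Qed.

Let sign_groupV A : A \in sign_group -> invmx A \in sign_group.
Proof.
move=> /sign_groupP[i ->].
suff -> : invmx (flip (w i)) = flip (w i) :> 'M[R]_n.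
  by apply/sign_groupP; exists i.
have FF : flip (w i) *m flip (w i) = 1%:M :> 'M[R]_n.
  rewrite mulmx_flip -flip_no_sign; congr flip.
  by apply/eqP; rewrite add_signs_eq0.
have [uF _] := mulmx1_unit FF.
by rewrite -[LHS]mulmx1 -FF mulKmx.
Qed.

Definition sign_orbifold : spherical_orbifold R d :=
  SphericalOrbifold sign_group_orthogonal sign_group1 sign_groupM sign_groupV.

Lemma sign_orbifold_vol :
  sphere_vol R d / #|I|%:R <= orbifold_vol sign_orbifold.
Proof.
apply: ler_wpM2l; first exact: sphere_vol_ge0.
have card_gt0 : (0 < #|` sign_group|)%N.
  by rewrite cardfs_gt0; apply/fset0Pn; exists 1%:M; exact: sign_group1.
rewrite lef_pV2 ?posrE ?ltr0n ?ler_nat//.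
  apply: leq_trans (leq_imfset_card _ _ _) _.
  by rewrite cardE.
by have [i _] := w0; apply/card_gt0P; exists i.
Qed.

Lemma invariant_sign_orbifold (f : 'cV[R]_n -> R) :
  Defs.invariant sign_orbifold f <->
  forall i x, sphere x -> f (flip (w i) *m x) = f x.
Proof.
split=> [fX i x Sx|fw A x /sign_groupP[i ->]]; last exact: fw.
by apply: fX => //; apply/sign_groupP; exists i.
Qed.

Definition in_dual K : bool := [forall i, ~~ parity (w i) K].

End SignOrbifolds.

Section Transplantation.
Context {R : realType} {d : nat} {I J : finType}.
Local Notation n := d.+1.
Local Notation signs := {ffun 'I_n -> bool}.
Variables (v : I -> signs) (w : J -> signs).
Hypothesis v0 : exists i, v i = no_sign.
Hypothesis vD : forall i j, exists k, v k = add_signs (v i) (v j).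
Hypothesis w0 : exists i, w i = no_sign.
Hypothesis wD : forall i j, exists k, w k = add_signs (w i) (w j).
Implicit Types f : 'cV[R]_n -> R.
Variables (beta : signs -> signs) (s : signs -> 'S_n).
Hypothesis beta_inj : injective beta.
Hypothesis beta_dual : forall K, in_dual v K -> in_dual w (beta K).
Hypothesis beta_perm : forall K i, beta K (s K i) = K i.

Local Notation X := (sign_orbifold (R := R) v0 vD).
Local Notation Y := (sign_orbifold (R := R) w0 wD).

(** Components outside the dual of v vanish on invariant functions; each of the
    others has its own permutation, since beta need not be induced by a single
    one. *)
Let transplant f x : R :=
  \sum_K (in_dual v K)%:R * component K f (perm_mx (s K) *m x).

Let moved_parity K f :
  has_parity (beta K) (fun x => component K f (perm_mx (s K) *m x)).
Proof.
move=> S x Sx /=; rewrite perm_mx_flip component_parity; last first.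
  exact: sphere_mulmx (perm_mx_orthogonal _) Sx.
congr (_ ^+ _ * _); rewrite -(parity_comp S _ (s K)).
congr (nat_of_bool (parity _ _)).
by apply/ffunP => i; rewrite ffunE beta_perm.
Qed.

(** The components of the transplant are the moved components of f, because
    beta is injective; so f can be recovered from its transplant. *)
Let component_transplant K f x : sphere x -> in_dual v K ->
  component (beta K) (transplant f) x = component K f (perm_mx (s K) *m x).
Proof.
move=> Sx vK; rewrite component_lincomb (bigD1 K)//=.
rewrite [X in _ + X]big1 => [|K' K'K].
  by rewrite (component_of_parity _ (moved_parity K f) Sx) eqxx vK !mul1r addr0.
rewrite (component_of_parity _ (moved_parity K' f) Sx).
by rewrite (inj_eq beta_inj) eq_sym (negbTE K'K) mul0r mulr0.
Qed.

(** A linear relation between the transplants gives the same relation between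
    the components on the dual code; the other components vanish by
    invariance. *)
Lemma transplant_free m (f : 'I_m -> 'cV[R]_n -> R) :
  (forall i, Defs.invariant X (f i)) -> free_on_sphere f ->
  free_on_sphere (fun i => transplant (f i)).
Proof.
move=> fX free_f c cT; apply: free_f => x Sx.
have -> : \sum_i c i * f i x = \sum_K \sum_i c i * component K (f i) x.
  rewrite exchange_big; apply: eq_bigr => i _.
  by rewrite -mulr_sumr sum_component.
apply: big1 => K _.
have [vK|/forallPn[i /negPn viK]] := boolP (in_dual v K); last first.
  apply: big1 => j _; rewrite (component_invariant Sx viK) ?mulr0// => y Sy.
  by have /invariant_sign_orbifold := fX j; apply.
pose y := perm_mx (s K)^-1 *m x : 'cV[R]_n.
have Sy : sphere y by apply: sphere_mulmx (perm_mx_orthogonal _) Sx.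
have -> : x = perm_mx (s K) *m y.
  by rewrite mulmxA -perm_mxM mulgV perm_mx1 mul1mx.
under eq_bigr do rewrite -component_transplant//.
rewrite -component_lincomb /component big1// => S _.
by rewrite cT ?mulr0//; exact: sphere_flip.
Qed.

Lemma transplant_invariant f : Defs.invariant Y (transplant f).
Proof.
apply/invariant_sign_orbifold => i x Sx; apply: eq_bigr => K _.
have [vK|_] := boolP (in_dual v K); last by rewrite !mul0r.
rewrite (moved_parity K f _ Sx).
by have /forallP/(_ i)/negbTE -> := beta_dual vK; rewrite mul1r.
Qed.

Lemma transplant_eigenfunction lambda f :
  laplace_eigenfunction lambda f -> laplace_eigenfunction lambda (transplant f).
Proof.
move=> Ef; apply: laplace_eigenfunction_lincomb => K.
apply: laplace_eigenfunction_mulmx; first exact: perm_mx_orthogonal.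
exact: laplace_eigenfunction_component.
Qed.

(** Transplantation maps a free family of invariant eigenfunctions of X to a
    family of Y with these properties and the same cardinality. *)
Lemma spectrum_transplant lambda : (spectrum X lambda <= spectrum Y lambda)%E.
Proof.
apply: ereal_sup_le => _ [m [f [free_f Ef]] <-].
exists m => //.
exists (fun i => transplant (f i)); split.
  by apply: transplant_free => // i; case: (Ef i).
move=> i; have [Ei _] := Ef i; split; last exact: transplant_invariant.
exact: transplant_eigenfunction.
Qed.

End Transplantation.

(** * The two codes and the bijection between their duals *)

Section Codes.
Context {d : nat}.
Hypothesis hd : (5 <= d)%N.
Local Notation n := d.+1.
Local Notation signs := {ffun 'I_n -> bool}.
Local Notation bool3 := (bool * bool * bool)%type.
Implicit Types (S K : signs).

Definition axis (k : nat) : 'I_n := inord k.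

(** The words generated by the pairs {0,5}, {1,3}, {2,4}. *)
Definition matching_word (b : bool3) : signs :=
  let: (b0, b1, b2) := b in
  [ffun i : 'I_n => nth false [:: b0; b1; b2; b1; b2; b0] i].

(** The words generated by {0,1}, {1,2} and {0,1,2,3,4,5}: the last three
    coordinates are equal to the sum of the first three. *)
Definition triangle_word (b : bool3) : signs :=
  let: (b0, b1, b2) := b in let c := b0 (+) b1 (+) b2 in
  [ffun i : 'I_n => nth false [:: b0; b1; b2; c; c; c] i].

Lemma matching_word0 : exists b, matching_word b = no_sign.
Proof.
exists (false, false, false); apply/ffunP => i; rewrite !ffunE.
by case: i => [[|[|[|[|[|[|k]]]]]] hk] //=; rewrite nth_nil.
Qed.

Lemma triangle_word0 : exists b, triangle_word b = no_sign.
Proof.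
exists (false, false, false); apply/ffunP => i; rewrite !ffunE.
by case: i => [[|[|[|[|[|[|k]]]]]] hk] //=; rewrite nth_nil.
Qed.

Lemma matching_wordD (b c : bool3) :
  exists e, matching_word e = add_signs (matching_word b) (matching_word c).
Proof.
case: b c => [[b0 b1] b2] [[c0 c1] c2].
exists (b0 (+) c0, b1 (+) c1, b2 (+) c2); apply/ffunP => i; rewrite !ffunE.
by case: i => [[|[|[|[|[|[|k]]]]]] hk] //=; rewrite !nth_nil.
Qed.

Lemma triangle_wordD (b c : bool3) :
  exists e, triangle_word e = add_signs (triangle_word b) (triangle_word c).
Proof.
case: b c => [[b0 b1] b2] [[c0 c1] c2].
exists (b0 (+) c0, b1 (+) c1, b2 (+) c2); apply/ffunP => i; rewrite !ffunE.
case: i => [[|[|[|[|[|[|k]]]]]] hk] //=; rewrite ?nth_nil//;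
  by case: b0 b1 b2 c0 c1 c2 => [] [] [] [] [] [].
Qed.

Lemma val_axis k : (k < 6)%N -> axis k = k :> nat.
Proof. by move=> k6; rewrite inordK// ltnS (leq_trans _ hd). Qed.

Lemma parity6 S K : (forall i : 'I_n, (6 <= i)%N -> S i = false) ->
  parity S K = (S (axis 0) && K (axis 0)) (+) ((S (axis 1) && K (axis 1)) (+)
    ((S (axis 2) && K (axis 2)) (+) ((S (axis 3) && K (axis 3)) (+)
    ((S (axis 4) && K (axis 4)) (+) (S (axis 5) && K (axis 5)))))).
Proof.
move=> S6.
have -> : parity S K = \big[addb/false]_(0 <= k < n) (S (axis k) && K (axis k)).
  by rewrite big_mkord; apply: eq_bigr => i _; rewrite /axis inord_val.
rewrite (@big_cat_nat _ _ _ 6)//= [X in _ (+) X]big_nat_cond [X in _ (+) X]big1.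
  by rewrite /index_iota /= !big_cons big_nil !addbF.
by move=> k /andP[/andP[k6 kn] _]; rewrite S6// inordK.
Qed.

(** In the first six coordinates, the matching code is its own dual. *)
Lemma dual_matching K : in_dual matching_word K =
  [&& K (axis 0) == K (axis 5), K (axis 1) == K (axis 3)
    & K (axis 2) == K (axis 4)].
Proof.
have mE b0 b1 b2 : parity (matching_word (b0, b1, b2)) K =
    (b0 && (K (axis 0) (+) K (axis 5))) (+) (b1 && (K (axis 1) (+) K (axis 3)))
    (+) (b2 && (K (axis 2) (+) K (axis 4))).
  rewrite parity6 ?ffunE ?val_axis//=; last first.
    by case=> [[|[|[|[|[|[|k]]]]]] hk] //= _; rewrite ffunE /= nth_nil.
  by move: (K _) (K _) (K _) (K _) (K _) (K _) b0 b1 b2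
    => [] [] [] [] [] [] [] [] [].
apply/forallP/and3P => [H|[/eqP e0 /eqP e1 /eqP e2] [[b0 b1] b2]].
  have := (H (true, false, false), H (false, true, false),
    H (false, false, true)).
  rewrite !mE /= !addbF.
  by case=> [[]]; move: (K _) (K _) (K _) (K _) (K _) (K _)
    => [] [] [] [] [] [].
by rewrite mE e0 e1 e2 !addbb !andbF.
Qed.

(** The pairs of the triangle force K to be constant on {0,1,2}, and the word of
    all six coordinates forces its weight there to be even; together, each of
    the first three values is the sum of the last three. *)
Lemma dual_triangle K : in_dual triangle_word K =
  let c := K (axis 3) (+) K (axis 4) (+) K (axis 5) in
  [&& K (axis 0) == c, K (axis 1) == c & K (axis 2) == c].
Proof.
cbv zeta; set c := _ (+) _ (+) _.
have tE b0 b1 b2 : parity (triangle_word (b0, b1, b2)) K =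
    (b0 && (K (axis 0) (+) c)) (+) (b1 && (K (axis 1) (+) c))
    (+) (b2 && (K (axis 2) (+) c)).
  rewrite parity6 ?ffunE ?val_axis//=; last first.
    by case=> [[|[|[|[|[|[|k]]]]]] hk] //= _; rewrite ffunE /= nth_nil.
  by rewrite /c; move: (K _) (K _) (K _) (K _) (K _) (K _) b0 b1 b2
    => [] [] [] [] [] [] [] [] [].
apply/forallP/and3P => [H|[/eqP e0 /eqP e1 /eqP e2] [[b0 b1] b2]].
  have := (H (true, false, false), H (false, true, false),
    H (false, false, true)).
  rewrite !tE /= !addbF.
  by case=> [[]]; move: (c) (K _) (K _) (K _) => [] [] [] [].
by rewrite tE e0 e1 e2 !addbb !andbF.
Qed.

(** The bijection of the duals exchanges some of the coordinates j and 3 + j for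
    j < 3.  These values are unchanged by any such exchange, so the exchanges
    can be chosen according to them and still form an involution. *)
Definition unbalanced K (j : nat) : bool := K (axis j) (+) K (axis (3 + j)).

Definition swapped K : bool3 :=
  (unbalanced K 0 && ~~ unbalanced K 1, unbalanced K 1 && ~~ unbalanced K 2,
   unbalanced K 2 && ~~ unbalanced K 0).

(** The default value k of [nth] leaves the coordinates from 6 on in place. *)
Definition swap_nat (z : bool3) (k : nat) : nat :=
  let: (z0, z1, z2) := z in
  nth k [:: if z0 then 3 else 0; if z1 then 4 else 1; if z2 then 5 else 2;
            if z0 then 0 else 3; if z1 then 1 else 4; if z2 then 2 else 5] k.

Lemma swap_natK z : involutive (swap_nat z).
Proof.
case: z => [[z0 z1] z2] [|[|[|[|[|[|k]]]]]];
  rewrite /= ?nth_nil;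
  [case: z0|case: z1|case: z2|case: z0|case: z1|case: z2|] => //=.
by rewrite nth_nil.
Qed.

Lemma swap_nat_lt6 z k : (k < 6)%N -> (swap_nat z k < 6)%N.
Proof.
by case: z => [[z0 z1] z2]; case: k => [|[|[|[|[|[|k]]]]]] //= _;
  [case: z0|case: z1|case: z2|case: z0|case: z1|case: z2].
Qed.

Lemma swap_nat_ge6 z k : (6 <= k)%N -> swap_nat z k = k.
Proof.
case: z => [[z0 z1] z2].
by case: k => [|[|[|[|[|[|k]]]]]] //= _; rewrite nth_nil.
Qed.

Lemma swap_nat_lt z (i : 'I_n) : (swap_nat z i < n)%N.
Proof.
have [i6|i6] := ltnP i 6; last by rewrite swap_nat_ge6.
by apply: leq_trans (swap_nat_lt6 z i6) _; rewrite ltnS.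
Qed.

Definition swap_ord z (i : 'I_n) : 'I_n := Ordinal (swap_nat_lt z i).

Lemma swap_ordK z : involutive (swap_ord z).
Proof. by move=> i; apply: val_inj; exact: swap_natK. Qed.

Definition swap_perm K : 'S_n := perm (inv_inj (swap_ordK (swapped K))).

(** Sends the words {0,5}, {1,3}, {2,4} of the dual of the matching code to
    {3,5}, {3,4}, {4,5} in the dual of the triangle code, and likewise for the
    complements in the first six coordinates. *)
Definition swap_signs K : signs := [ffun i => K (swap_perm K i)].

Lemma swap_signs_axis K k : (k < 6)%N ->
  swap_signs K (axis k) = K (axis (swap_nat (swapped K) k)).
Proof.
move=> k6; rewrite ffunE permE; congr (K _); apply: val_inj.
by rewrite [LHS]/(swap_nat _ (axis k)) [RHS]val_axis ?swap_nat_lt6// val_axis.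
Qed.

(** The choice of the exchanges is unaffected by performing them, which makes
    [swap_signs] an involution. *)
Lemma swapped_swap_signs K : swapped (swap_signs K) = swapped K.
Proof.
rewrite /swapped /unbalanced !swap_signs_axis//.
rewrite /= /unbalanced /=.
case E0: (K (axis 0)); case E1: (K (axis 1)); case E2: (K (axis 2));
case E3: (K (axis 3)); case E4: (K (axis 4)); case E5: (K (axis 5)) => /=;
by rewrite ?E0 ?E1 ?E2 ?E3 ?E4 ?E5.
Qed.

Lemma swap_signs_perm K i : swap_signs K (swap_perm K i) = K i.
Proof. by rewrite ffunE !permE swap_ordK. Qed.

Lemma swap_signsK : involutive swap_signs.
Proof.
move=> K; apply/ffunP => i; rewrite ffunE -[RHS]swap_signs_perm.
by rewrite !permE swapped_swap_signs.
Qed.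

(** A finite verification: only the first six coordinates matter. *)
Lemma dual_swap_signs K :
  in_dual triangle_word (swap_signs K) = in_dual matching_word K.
Proof.
rewrite dual_triangle dual_matching !swap_signs_axis//.
rewrite /= /unbalanced /=.
case E0: (K (axis 0)); case E1: (K (axis 1)); case E2: (K (axis 2));
case E3: (K (axis 3)); case E4: (K (axis 4)); case E5: (K (axis 5)) => /=;
by rewrite ?E0 ?E1 ?E2 ?E3 ?E4 ?E5.
Qed.

End Codes.

Section Pair.
Context (R : realType) (d : nat).
Hypothesis hd : (5 <= d)%N.

Definition matching_orbifold : spherical_orbifold R d :=
  sign_orbifold matching_word0 matching_wordD.

Definition triangle_orbifold : spherical_orbifold R d :=
  sign_orbifold triangle_word0 triangle_wordD.

Lemma isospectral_matching_triangle :
  isospectral matching_orbifold triangle_orbifold.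
Proof.
move=> lambda; have swap_inj := inv_inj (swap_signsK hd).
apply/eqP; rewrite eq_le; apply/andP; split.
  apply: (spectrum_transplant _ _ _ _ swap_inj _ (swap_signs_perm hd)) => K.
  by rewrite dual_swap_signs.
apply: (spectrum_transplant _ _ _ _ swap_inj _ (swap_signs_perm hd)) => K.
by rewrite -(dual_swap_signs hd) swap_signsK.
Qed.

Lemma card_bool3 : #|{: bool * bool * bool}| = 8.
Proof. by rewrite !card_prod card_bool. Qed.

End Pair.

(** * Distances between orbits and a metric invariant *)

Section MetricInvariant.
Context {R : realType} {d : nat}.
Implicit Types (X Y : spherical_orbifold R d) (p q r : set 'cV[R]_d.+1).

Definition has_antipode X p :=
  exists2 q, orbifold_points X q & orbit_dist p q = pi.

(** Antipodes are lost in the six coordinates on which the group acts, so they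
    detect the fixed coordinates; being equatorial means that these vanish. *)
Definition equatorial X p := orbifold_points X p /\
  forall q, orbifold_points X q -> has_antipode X q -> orbit_dist p q = pi / 2.

(** When the equatorial part is the spherical join of p with its polar set, a
    point q at distance other than pi/2 from p has a nonzero component along p,
    and a point r at distance pi/2 from q must have none; the definition records
    this consequence, which is expressed by distances only. *)
Definition join_vertex X p := equatorial X p /\
  forall q r, equatorial X q -> equatorial X r ->
    orbit_dist p q <> pi / 2 -> orbit_dist q r = pi / 2 ->
    orbit_dist p r = pi / 2.

Lemma isometric_join_vertex X Y : isometric X Y ->
  (exists p, join_vertex Y p) -> exists p, join_vertex X p.
Proof.
move=> [F [[funF injF surjF] distF]].
have antiF p : orbifold_points X p -> has_antipode X p -> has_antipode Y (F p).
  by move=> Xp [q Xq pq]; exists (F q); [exact: funF|rewrite distF].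
have antiFV p : orbifold_points X p -> has_antipode Y (F p) -> has_antipode X p.
  move=> Xp [_ /surjF[q Xq <-] pq]; exists q => //; by rewrite -distF.
have eqF p : equatorial X p -> equatorial Y (F p).
  move=> [Xp ep]; split; first exact: funF.
  move=> _ /surjF[q Xq <-] aq; rewrite distF//; apply: ep => //; exact: antiFV.
move=> [_ [[/surjF[p Xp <-] ep] jp]]; exists p; split.
  split=> // q Xq aq; rewrite -distF//; apply: ep (antiF _ Xq aq); exact: funF.
move=> q r eq er pq qr.
have [[Xq _] [Xr _]] := (eq, er).
by rewrite -distF//; apply: (jp (F q)); rewrite ?distF//; exact: eqF.
Qed.

End MetricInvariant.

Section OrbitDistance.
Context {R : realType} {d : nat}.
Local Notation n := d.+1.
Implicit Types (x y z : 'cV[R]_n) (p q : set 'cV[R]_n).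

Lemma dotC x y : dot x y = dot y x.
Proof. by apply: eq_bigr => i _; rewrite mulrC. Qed.

Lemma dotDl x y z : dot (x + y) z = dot x z + dot y z.
Proof.
by rewrite /dot -big_split; apply: eq_bigr => i _; rewrite mxE mulrDl.
Qed.

Lemma dotZl a x z : dot (a *: x) z = a * dot x z.
Proof. by rewrite /dot mulr_sumr; apply: eq_bigr => i _; rewrite mxE mulrA. Qed.

Lemma dotDr x y z : dot z (x + y) = dot z x + dot z y.
Proof. by rewrite dotC dotDl ![dot _ z]dotC. Qed.

Lemma dotZr a x z : dot z (a *: x) = a * dot z x.
Proof. by rewrite dotC dotZl dotC. Qed.

Lemma dot_deltar x l : dot x (delta_mx l 0) = x l 0.
Proof.
rewrite /dot (bigD1 l)//= !mxE !eqxx mulr1 big1 ?addr0// => i il.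
by rewrite !mxE (negbTE il) mulr0.
Qed.

Lemma dot_ge0 x : 0 <= dot x x.
Proof. by apply: sumr_ge0 => i _; rewrite -expr2 sqr_ge0. Qed.

Lemma dot_eq0 x : dot x x <= 0 -> x = 0.
Proof.
move=> xx; have {}xx : dot x x == 0 by rewrite eq_le xx dot_ge0.
apply/colP => i; rewrite mxE; apply/eqP; rewrite -sqrf_eq0 expr2.
move: xx; rewrite psumr_eq0 => [/allP/(_ i)/=|k _]; last first.
  by rewrite -expr2 sqr_ge0.
by rewrite mem_index_enum => /(_ isT).
Qed.

Lemma dot_sphere x y : sphere x -> sphere y -> -1 <= dot x y <= 1.
Proof.
move=> Sx Sy; apply/andP; split.
  have := dot_ge0 (x + y); rewrite !dotDl !dotDr Sx Sy [dot y x]dotC; lra.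
have := dot_ge0 (x + -1 *: y).
rewrite !dotDl !dotDr !dotZl !dotZr Sx Sy [dot y x]dotC; lra.
Qed.

Lemma le_acos (t a : R) : 0 <= t <= pi -> -1 <= a <= 1 -> t <= acos a ->
  a <= cos t.
Proof.
move=> t0pi a11 ta; rewrite -[a]acosK ?in_itv//=.
rewrite leNgt ltr_cos -?leNgt ?in_itv//=.
by rewrite acos_ge0// acos_lepi.
Qed.

Lemma orbit_dist_le p q x y : p `<=` sphere -> q `<=` sphere -> p x -> q y ->
  orbit_dist p q <= acos (dot x y).
Proof.
move=> pS qS px qy; apply: ge_inf; last by exists x, y.
exists 0 => _ [x' [y' [px' qy' ->]]].
by apply: acos_ge0; apply: dot_sphere; [exact: pS|exact: qS].
Qed.

Lemma orbit_dist_cst p q (c : R) : p !=set0 -> q !=set0 ->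
  (forall x y, p x -> q y -> dot x y = c) -> orbit_dist p q = acos c.
Proof.
move=> [x px] [y qy] cE; rewrite /orbit_dist (_ : [set _ | _] = [set acos c]).
  exact: inf1.
apply/seteqP; split=> [_ [x' [y' [px' qy' ->]]]|_ ->] /=.
  by rewrite /sphere_dist cE.
by exists x, y; rewrite /sphere_dist cE.
Qed.

End OrbitDistance.

(** * Distances in quotients by codes on the first six coordinates *)

Section SixCoordinates.
Context {R : realType} {d : nat} {I : finType}.
Local Notation n := d.+1.
Local Notation signs := {ffun 'I_n -> bool}.
Variable w : I -> signs.
Hypothesis w0 : exists i, w i = no_sign.
Hypothesis wD : forall i j, exists k, w k = add_signs (w i) (w j).
Hypothesis w_six : exists i, forall l : 'I_n, w i l = (l < 6)%N.
Hypothesis w_pad : forall i (l : 'I_n), (6 <= l)%N -> w i l = false.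
Implicit Types (x y z : 'cV[R]_n) (l : 'I_n).

Local Notation X := (sign_orbifold (R := R) w0 wD).
Local Notation orb x := (Defs.orbit X x).

Lemma orbit_flip i x : orb x (flip (w i) *m x).
Proof. by exists (flip (w i)) => //=; apply/sign_groupP; exists i. Qed.

Lemma orbit_refl x : orb x x.
Proof. by have [i wi] := w0; have := orbit_flip i x; rewrite wi flip0. Qed.

Lemma orbitP x y : orb x y -> exists i, y = flip (w i) *m x.
Proof. by move=> [A /= /sign_groupP[i ->] <-]; exists i. Qed.

Lemma orbit_sphere x : sphere x -> orb x `<=` sphere.
Proof. by move=> Sx _ /orbitP[i ->]; exact: sphere_flip. Qed.

Lemma orbifold_points_orbit x : sphere x -> orbifold_points X (orb x).
Proof. by move=> Sx; exists x. Qed.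

Lemma dot_flip S x y :
  dot x (flip S *m y) = \sum_l (-1) ^+ S l * (x l 0 * y l 0).
Proof. by apply: eq_bigr => l _; rewrite flipE mulrCA. Qed.

Lemma dot_flipC S x y : dot (flip S *m x) y = dot x (flip S *m y).
Proof.
by rewrite dotC !dot_flip; apply: eq_bigr => l _; rewrite [y l 0 * _]mulrC.
Qed.

Lemma dist_orbit_le i x y t : sphere x -> sphere y -> 0 <= t <= pi ->
  orbit_dist (orb x) (orb y) = t -> dot x (flip (w i) *m y) <= cos t.
Proof.
move=> Sx Sy t0pi xyt; apply: le_acos => //.
  by apply: dot_sphere => //; exact: sphere_flip.
rewrite -xyt; apply: orbit_dist_le.
- exact: orbit_sphere.
- exact: orbit_sphere.
- exact: orbit_refl.
- exact: orbit_flip.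
Qed.

Lemma dist_orbit_cst x y (c : R) : (forall i, dot x (flip (w i) *m y) = c) ->
  orbit_dist (orb x) (orb y) = acos c.
Proof.
move=> xyc; apply: orbit_dist_cst.
- by exists x; exact: orbit_refl.
- by exists y; exact: orbit_refl.
move=> _ _ /orbitP[i ->] /orbitP[j ->]; have [k wk] := wD i j.
by rewrite dot_flipC flipD -wk.
Qed.

(** At distance pi, all points of the orbit of an antipode y are equal to -x; so
    y is fixed
    by the group, in particular by the change of all six signs. *)
Lemma antipode_six_eq0 x l : sphere x -> has_antipode X (orb x) -> (l < 6)%N ->
  x l 0 = 0.
Proof.
move=> Sx [_ [y Sy <-] xy] l6.
have pi_pi : 0 <= (pi : R) <= pi by rewrite pi_ge0 lexx.
have opp i : flip (w i) *m y = - x.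
  have := dist_orbit_le i Sx Sy pi_pi xy; rewrite cospi => xyi.
  apply/eqP; rewrite -addr_eq0 addrC; apply/eqP/dot_eq0.
  have := sphere_flip (w i) Sy; rewrite /sphere /= => Sfy.
  by rewrite !dotDl !dotDr Sx Sfy [dot (flip _ *m y) x]dotC; lra.
have [[i wi] [j wj]] := (w0, w_six).
have := opp j; rewrite -(opp i) wi flip0 => /colP/(_ l).
rewrite flipE wj l6 => yl.
by have := opp i; rewrite wi flip0 => /colP/(_ l); rewrite mxE; lra.
Qed.

(** Points having an antipode live on the fixed coordinates, so they are
    perpendicular to x when the fixed coordinates of x vanish.  Conversely the
    unit vectors along the fixed coordinates and their opposites are antipodal,
    and their distance to x bounds each fixed coordinate of x on both sides. *)
Lemma equatorialP x : sphere x ->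
  equatorial X (orb x) <-> forall l, (6 <= l)%N -> x l 0 = 0.
Proof.
move=> Sx; split=> [[_ ex] l l6|x0]; last first.
  split=> [|_ [y Sy <-] ay]; first exact: orbifold_points_orbit.
  rewrite (@dist_orbit_cst x y 0) ?acos0// => i.
  rewrite dot_flip big1// => l _; have [l6|l6] := ltnP l 6.
    by rewrite (antipode_six_eq0 Sy ay l6) !mulr0.
  by rewrite x0// mul0r mulr0.
pose e (a : R) : 'cV[R]_n := a *: delta_mx l 0.
have Se a : a ^+ 2 = 1 -> sphere (e a).
  move=> a1; rewrite /sphere /= dotZl dotZr dot_deltar.
  by rewrite mxE !eqxx mulr1 -expr2.
have flipe a i : flip (w i) *m e a = e a.
  apply/colP => k; rewrite flipE !mxE; have [->|_] := eqVneq k l.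
    by rewrite w_pad// mul1r.
  by rewrite !mulr0.
have ee a : a ^+ 2 = 1 -> has_antipode X (orb (e a)).
  move=> a1; exists (orb (e (- a))).
    by apply: orbifold_points_orbit; apply: Se; rewrite sqrrN.
  rewrite (@dist_orbit_cst _ _ (-1)) ?acosN1// => i.
  by rewrite flipe dotZl dotZr dot_deltar mxE !eqxx mulr1 mulrN -expr2 a1.
have pih : 0 <= (pi / 2 : R) <= pi by have := pi_ge0 R; lra.
have xe a : a ^+ 2 = 1 -> a * x l 0 <= 0.
  move=> a1; have [i _] := w0.
  have := dist_orbit_le i Sx (Se a a1) pih
    (ex _ (orbifold_points_orbit (Se a a1)) (ee a a1)).
  by rewrite flipe dotZr dot_deltar cos_pihalf.
have := xe 1 (expr1n _ _).
by have := xe (-1); rewrite sqrrN expr1n => /(_ erefl); lra.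
Qed.

(** Distance pi/2 says that the largest dot product between the orbits is 0;
    since the group contains the opposite of the identity of the first six
    coordinates, all of them vanish. *)
Lemma dist_orbit_pihalfP x y : sphere x -> sphere y -> equatorial X (orb x) ->
  orbit_dist (orb x) (orb y) = pi / 2 <-> forall i, dot x (flip (w i) *m y) = 0.
Proof.
move=> Sx Sy /(equatorialP Sx) x0; split=> [xy i|xy]; last first.
  by rewrite (dist_orbit_cst xy) acos0.
have pih : 0 <= (pi / 2 : R) <= pi by have := pi_ge0 R; lra.
have [j wj] := w_six; have [k wk] := wD j i.
have := dist_orbit_le i Sx Sy pih xy; have := dist_orbit_le k Sx Sy pih xy.
rewrite cos_pihalf wk -flipD.
have -> : dot x (flip (w j) *m (flip (w i) *m y)) = - dot x (flip (w i) *m y).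
  rewrite dot_flip /dot -sumrN; apply: eq_bigr => l _; rewrite wj.
  by have [l6|l6] := ltnP l 6; [rewrite mulN1r|rewrite x0// mul0r mulr0 oppr0].
lra.
Qed.

End SixCoordinates.

(** * The two quotients are not isometric *)

Section NonIsometric.
Context {R : realType} {d : nat}.
Hypothesis hd : (5 <= d)%N.
Local Notation n := d.+1.
Implicit Types (x y z : 'cV[R]_n).
Local Notation X := (matching_orbifold R d).
Local Notation Y := (triangle_orbifold R d).

Lemma matching_word_six :
  exists b, forall l : 'I_n, matching_word b l = (l < 6)%N.
Proof.
exists (true, true, true) => l; rewrite ffunE.
by case: l => [[|[|[|[|[|[|k]]]]]] hk] //=; rewrite nth_nil.
Qed.

Lemma triangle_word_six :
  exists b, forall l : 'I_n, triangle_word b l = (l < 6)%N.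
Proof.
exists (true, true, true) => l; rewrite ffunE.
by case: l => [[|[|[|[|[|[|k]]]]]] hk] //=; rewrite nth_nil.
Qed.

Lemma matching_word_pad b (l : 'I_n) : (6 <= l)%N -> matching_word b l = false.
Proof.
case: b => [[b0 b1] b2]; rewrite ffunE.
by case: l => [[|[|[|[|[|[|k]]]]]] hk] //=; rewrite nth_nil.
Qed.

Lemma triangle_word_pad b (l : 'I_n) : (6 <= l)%N -> triangle_word b l = false.
Proof.
case: b => [[b0 b1] b2]; rewrite ffunE.
by case: l => [[|[|[|[|[|[|k]]]]]] hk] //=; rewrite nth_nil.
Qed.

Let equatorialX := @equatorialP R d _ _
  matching_word0 matching_wordD matching_word_six matching_word_pad.
Let equatorialY := @equatorialP R d _ _
  triangle_word0 triangle_wordD triangle_word_six triangle_word_pad.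
Let pihalfX := @dist_orbit_pihalfP R d _ _
  matching_word0 matching_wordD matching_word_six matching_word_pad.
Let pihalfY := @dist_orbit_pihalfP R d _ _
  triangle_word0 triangle_wordD triangle_word_six triangle_word_pad.

Lemma dot_flip_pair (S : {ffun 'I_n -> bool}) (a b : 'I_n) x y : a != b ->
  (forall l, S l = (l == a) || (l == b)) ->
  dot x (flip S *m y) = dot x y - 2 * (x a 0 * y a 0 + x b 0 * y b 0).
Proof.
move=> ab Sab; rewrite dot_flip /dot (bigD1 a)//= (bigD1 b) 1?eq_sym//=.
rewrite [in RHS](bigD1 a)//= [in RHS](bigD1 b) 1?eq_sym//=.
rewrite !Sab !eqxx orbT /= !mulN1r.
rewrite (eq_bigr (fun l => x l 0 * y l 0)) => [|l /andP[la lb]]; first by ring.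
by rewrite Sab (negbTE la) (negbTE lb) mul1r.
Qed.

Lemma axis_neq (j k : nat) : (j < 6)%N -> (k < 6)%N -> j != k ->
  axis j != axis k :> 'I_n.
Proof. by move=> j6 k6; rewrite -val_eqE /= !(val_axis hd). Qed.

Lemma eq_axis (l : 'I_n) k : (k < 6)%N -> (l == axis k) = (l == k :> nat).
Proof. by move=> k6; rewrite -val_eqE /= (val_axis hd). Qed.

(** The sign changes of {0,1}, {1,2} and {0,2} separate coordinate 0 from all
    the others. *)
Lemma triangle_isotypic x y :
  (forall b, dot x (flip (triangle_word b) *m y) = 0) ->
  x (axis 0) 0 * y (axis 0) 0 = 0.
Proof.
move=> xy.
have xy0 : dot x y = 0.
  by have [b wb] := @triangle_word0 d; have := xy b; rewrite wb flip0.
have pair j k b0 b1 b2 : (j < 6)%N -> (k < 6)%N -> j != k ->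
    (forall l, nth false [:: b0; b1; b2; b0 (+) b1 (+) b2; b0 (+) b1 (+) b2;
      b0 (+) b1 (+) b2] l = (l == j) || (l == k)) ->
    x (axis j) 0 * y (axis j) 0 + x (axis k) 0 * y (axis k) 0 = 0.
  move=> j6 k6 jk wl; have := xy (b0, b1, b2).
  rewrite (dot_flip_pair _ _ (axis_neq j6 k6 jk)) ?xy0; first by lra.
  by move=> l; rewrite ffunE wl !eq_axis.
have nth01 l : nth false [:: true; true; false; false; false; false] l =
    (l == 0%N) || (l == 1%N).
  by case: l => [|[|[|[|[|[|l]]]]]] //=; rewrite nth_nil.
have nth12 l : nth false [:: false; true; true; false; false; false] l =
    (l == 1%N) || (l == 2%N).
  by case: l => [|[|[|[|[|[|l]]]]]] //=; rewrite nth_nil.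
have nth02 l : nth false [:: true; false; true; false; false; false] l =
    (l == 0%N) || (l == 2%N).
  by case: l => [|[|[|[|[|[|l]]]]]] //=; rewrite nth_nil.
have := pair 0%N 1%N true true false isT isT isT nth01.
have := pair 1%N 2%N false true true isT isT isT nth12.
have := pair 0%N 2%N true false true isT isT isT nth02.
lra.
Qed.

Lemma join_vertex_triangle : exists p, join_vertex Y p.
Proof.
pose e : 'cV[R]_n := delta_mx (axis 0) 0.
have Se : sphere e by rewrite /sphere /= dot_deltar mxE !eqxx.
have ee : equatorial Y (Defs.orbit Y e).
  apply/(equatorialY Se) => l l6; rewrite mxE eq_axis//.
  by case: (val l) l6.
exists (Defs.orbit Y e); split=> // q r [[y Sy <-] ey] [[z Sz <-] ez] ey_neq yz.
have {}ey : equatorial Y (Defs.orbit Y y) by split => //; exists y.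
have dote x b : dot e (flip (triangle_word b) *m x) =
    (-1) ^+ @triangle_word d b (axis 0) * x (axis 0) 0.
  by rewrite dotC dot_deltar flipE.
have /(pihalfY Sy Sz ey) yz0 := yz.
have /eqP := triangle_isotypic yz0; rewrite mulf_eq0 => /orP[|] /eqP x0.
  by case: ey_neq; apply/pihalfY => // b; rewrite dote x0 mulr0.
by apply/pihalfY => // b; rewrite dote x0 mulr0.
Qed.

(** The first six coordinates of x are not all zero, so x has a nonzero
    projection on the plane of some matched pair {a,b}.  In this plane let q and
    r be the projection rotated by 45 degrees in the two directions: they are
    perpendicular to each other, and neither is perpendicular to x. *)
Lemma no_join_vertex_matching : ~ exists p, join_vertex X p.
Proof.
move=> [_ [[[x Sx <-] ex] jx]].
have {}ex : equatorial X (Defs.orbit X x) by split => //; exists x.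
have x0 := (equatorialX Sx).1 ex.
have [a [b [a6 b6 ab wab xab]]] : exists a b : 'I_n,
  [/\ (a < 6)%N, (b < 6)%N, a != b,
    forall c, matching_word c a = matching_word c b
    & 0 < x a 0 ^+ 2 + x b 0 ^+ 2].
  have sq2 (s t : R) : (s != 0) || (t != 0) -> 0 < s ^+ 2 + t ^+ 2.
    by case/orP => st; [apply: ltr_pwDl|apply: ltr_wpDl];
      rewrite ?sqr_ge0// lt0r sqrf_eq0 st sqr_ge0.
  have pairs j k : (j < 6)%N -> (k < 6)%N -> j != k ->
      (forall c, @matching_word d c (axis j) = @matching_word d c (axis k)) ->
      (x (axis j) 0 != 0) || (x (axis k) 0 != 0) -> exists a b : 'I_n,
      [/\ (a < 6)%N, (b < 6)%N, a != b,
          forall c, matching_word c a = matching_word c b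
        & 0 < x a 0 ^+ 2 + x b 0 ^+ 2].
    move=> j6 k6 jk wjk xjk; exists (axis j), (axis k).
    split; [by rewrite (val_axis hd)|by rewrite (val_axis hd)| | |].
    - exact: axis_neq.
    - exact: wjk.
    - exact: sq2.
  have [xl|/forallNP xl] := pselect (exists l, x l 0 != 0); last first.
    exfalso; move: Sx; rewrite /sphere /= /dot big1 => [/eqP|l _].
      by rewrite eq_sym oner_eq0.
    by have /negP := xl l; rewrite negbK => /eqP ->; rewrite mul0r.
  have [l xl0] := xl.
  have l6 : (l < 6)%N by rewrite ltnNge; apply: contra xl0 => /x0/eqP.
  have lE : l = axis l by rewrite /axis inord_val.
  have w05 c : @matching_word d c (axis 0) = @matching_word d c (axis 5).
    by case: c => [[c0 c1] c2]; rewrite !ffunE !(val_axis hd).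
  have w13 c : @matching_word d c (axis 1) = @matching_word d c (axis 3).
    by case: c => [[c0 c1] c2]; rewrite !ffunE !(val_axis hd).
  have w24 c : @matching_word d c (axis 2) = @matching_word d c (axis 4).
    by case: c => [[c0 c1] c2]; rewrite !ffunE !(val_axis hd).
  move: xl0; rewrite lE; case: (val l) l6 => [|[|[|[|[|[|]]]]]] // _ xl0.
  - by apply: (pairs 0%N 5%N) => //; rewrite xl0.
  - by apply: (pairs 1%N 3%N) => //; rewrite xl0.
  - by apply: (pairs 2%N 4%N) => //; rewrite xl0.
  - by apply: (pairs 1%N 3%N) => //; rewrite xl0 orbT.
  - by apply: (pairs 2%N 4%N) => //; rewrite xl0 orbT.
  - by apply: (pairs 0%N 5%N) => //; rewrite xl0 orbT.
(* The rotated vectors below have squared norm 2 * N2 before normalization. *)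
pose N2 := x a 0 ^+ 2 + x b 0 ^+ 2; pose c := (Num.sqrt (2 * N2))^-1.
have c2 : c ^+ 2 * (2 * N2) = 1.
  rewrite exprVn sqr_sqrtr ?mulVf//; [rewrite mulf_neq0//|rewrite mulr_ge0//].
  - exact: lt0r_neq0.
  - exact: ltW.
have c0 : c != 0.
  by apply: contra_eq_neq c2 => ->; rewrite expr0n mul0r eq_sym oner_eq0.
pose vec (s t : R) : 'cV[R]_n := c *: (s *: delta_mx a 0 + t *: delta_mx b 0).
have dot_vec y s t : dot y (vec s t) = c * (s * y a 0 + t * y b 0).
  by rewrite dotZr dotDr !dotZr !dot_deltar.
have vec_a s t : vec s t a 0 = c * s.
  by rewrite !mxE !eqxx (negbTE ab) mulr1 mulr0 addr0.
have vec_b s t : vec s t b 0 = c * t.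
  by rewrite !mxE !eqxx [b == a]eq_sym (negbTE ab) mulr1 mulr0 add0r.
have dot_flip_vec w y s t : dot y (flip (matching_word w) *m vec s t) =
    (-1) ^+ @matching_word d w a * (c * (s * y a 0 + t * y b 0)).
  rewrite -dot_flipC dot_vec !flipE -wab; ring.
have S_vec s t : s ^+ 2 + t ^+ 2 = 2 * N2 -> sphere (vec s t).
  by move=> st; rewrite /sphere /= dot_vec vec_a vec_b -c2 -st; ring.
have e_vec s t : s ^+ 2 + t ^+ 2 = 2 * N2 ->
    equatorial X (Defs.orbit X (vec s t)).
  move=> st; apply/(equatorialX (S_vec _ _ st)) => l l6; rewrite !mxE.
  have /negbTE -> : l != a by apply: contraTneq l6 => ->; rewrite -ltnNge.
  have /negbTE -> : l != b by apply: contraTneq l6 => ->; rewrite -ltnNge.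
  by rewrite !mulr0 addr0 mulr0.
pose s := x a 0 - x b 0; pose t := x a 0 + x b 0.
have st : s ^+ 2 + t ^+ 2 = 2 * N2 by rewrite /s /t /N2; ring.
have ts : t ^+ 2 + (- s) ^+ 2 = 2 * N2 by rewrite /s /t /N2; ring.
have not_pihalf u v : u * x a 0 + v * x b 0 = N2 -> u ^+ 2 + v ^+ 2 = 2 * N2 ->
    orbit_dist (Defs.orbit X x) (Defs.orbit X (vec u v)) <> pi / 2.
  move=> uvN uv /(pihalfX Sx (S_vec _ _ uv) ex).
  have [w w0] := @matching_word0 d; move=> /(_ w) /eqP.
  by rewrite w0 flip0 dot_vec uvN mulf_eq0 (negbTE c0) (gt_eqF xab).
apply: (not_pihalf t (- s) _ ts); first by rewrite /s /t /N2; ring.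
apply: (jx (Defs.orbit X (vec s t))); [exact: e_vec|exact: e_vec| |].
  by apply: not_pihalf st; rewrite /s /t /N2; ring.
apply/(pihalfX (S_vec _ _ st) (S_vec _ _ ts) (e_vec _ _ st)) => w.
by rewrite dot_flip_vec vec_a vec_b; ring.
Qed.

Lemma not_isometric_matching_triangle : ~ isometric X Y.
Proof.
move=> XY; apply: no_join_vertex_matching.
exact: isometric_join_vertex XY join_vertex_triangle.
Qed.

End NonIsometric.

Theorem theorem1p5 (R : realType) (d : nat) (hd : (5 <= d)%N) :
  exists X Y : spherical_orbifold R d,
    [/\ isospectral X Y,
        ~ isometric X Y,
        1 / 8 * sphere_vol R d <= orbifold_vol X
      & 1 / 8 * sphere_vol R d <= orbifold_vol Y].
Proof.
have volE : 1 / 8 * sphere_vol R d =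
    sphere_vol R d / #|{: bool * bool * bool}|%:R.
  by rewrite card_bool3 mul1r mulrC.
exists (matching_orbifold R d), (triangle_orbifold R d); split.
- exact: isospectral_matching_triangle.
- exact: not_isometric_matching_triangle.
- by rewrite volE; exact: sign_orbifold_vol.
- by rewrite volE; exact: sign_orbifold_vol.
Qed.
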